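(* Let $m\in\mathbb N$ and let $f:\mathbb R\to\mathbb T\mathbb P^m$ be a $1$-st tropical holomorphic curve with a reduced representation $\mathbf f=(f_0,\dots,f_m)$. If $$\limsup_{r\to+\infty}\frac{\log\log T_f(r)}{\log r}=:\rho_2<1$$ and $\sigma\in(0,1-\rho_2)$, then $$\sum_{i=0}^mN\left(r,1_0\oslash f_i\right)=N\left(r,1_0\oslash C_0(f_0,\dots,f_m)\right)+o\left(\frac{T_f(r)}{r^{\sigma}}\right),$$ where $r$ approaches infinity outside an exceptional set of finite logarithmic measure.
   Context: $\mathbb N=\{1,2,\dots\}$. $a\oslash b=a-b$ and $1_0=0$, so $1_0\oslash g=-g$. A $1$-st tropical meromorphic function is a non-constant continuous piecewise linear function $g:\mathbb R\to\mathbb R$ whose breakpoints have no finite accumulation point. $\omega_g(x)=g'(x^+)-g'(x^-)$; $x$ is a root (pole) of $g$ if $\omega_g(x)>0$ ($<0$), with multiplicity $|\omega_g(x)|$. $g$ is tropical entire if it has no poles. $N(r,g)=\frac12\sum_z|\omega_g(z)|(r-|z|)$, over all poles $z$ of $g$ in $(-r,r)$ (so $N(r,1_0\oslash g)$ counts the roots of $g$). $\mathbb T\mathbb P^m$ is the quotient of $(\mathbb R\cup\{-\infty\})^{m+1}\setminus\{(-\infty,\dots,-\infty)\}$ by $(a_0,\dots,a_m)\sim(a_0+\lambda,\dots,a_m+\lambda)$, $\lambda\in\mathbb R$. A $1$-st tropical holomorphic curve is a map $f=[f_0:\cdots:f_m]:\mathbb R\to\mathbb T\mathbb P^m$ where each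 $f_i$ is a $1$-st tropical entire function or a constant, not all constant. The tuple $(f_0,\dots,f_m)$ is a reduced representation if no point is a root common to all of $f_0,\dots,f_m$. $T_f(r)=\frac12(F(r)+F(-r))-F(0)$ with $F=\max_{0\le i\le m}f_i$ (for a reduced representation). Shifts: $\overline g^{[k]}(x)=g(x+k)$. The tropical Casoratian is $C_0(f_0,\dots,f_m)(x)=\max_\pi\sum_{i=0}^m\overline f_i^{[\pi(i)]}(x)$, the maximum over all permutations $\pi$ of $\{0,\dots,m\}$. A set $E\subset(0,\infty)$ has finite logarithmic measure if $\int_{E\cap[1,\infty)}dr/r<\infty$. *)

(* Defs.v *)
From HB Require Import structures.
From mathcomp Require Import all_boot all_order all_algebra all_fingroup.
From mathcomp Require Import generic_quotient.
From mathcomp Require Import all_classical all_reals all_analysis.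
Set Implicit Arguments.
Unset Strict Implicit.
Unset Printing Implicit Defensive.
Import Order.TTheory GRing.Theory Num.Theory.
Import numFieldNormedType.Exports.
Local Open Scope classical_set_scope.
Local Open Scope ring_scope.

Section TropicalFunctions.
Variable R : realType.
Implicit Types (g : R -> R) (r x z : R).

(* [B] contains the breakpoints of [g]; having no limit point in R, it meets
   every bounded interval in a finite set. *)
Definition piecewise_linear g : Prop :=
  exists2 B : set R, limit_point B = set0 &
    forall a b : R, `]a, b[ `&` B = set0 ->
      exists s c : R, forall x, x \in `]a, b[ -> g x = s * x + c.

Definition constant_fun g : Prop := exists c : R, forall x, g x = c.

Definition tropical_meromorphic g : Prop :=
  [/\ ~ constant_fun g, continuous g & piecewise_linear g].

Definition right_derivative g x : R :=
  lim ((h^-1 * (g (x + h) - g x)) @[h --> 0^'+]).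

Definition left_derivative g x : R :=
  lim ((h^-1 * (g (x + h) - g x)) @[h --> 0^'-]).

Definition omega g x : R := right_derivative g x - left_derivative g x.

Definition tropical_root g x : Prop := 0 < omega g x.

Definition tropical_pole g x : Prop := omega g x < 0.

Definition tropical_entire g : Prop :=
  tropical_meromorphic g /\ forall x, ~ tropical_pole g x.

(* The sum has finite support when [g] is constant or tropical meromorphic. *)
Definition counting_function r g : R :=
  2^-1 * \sum_(z \in [set z | tropical_pole g z /\ z \in `]- r, r[])
           `|omega g z| * (r - `|z|).

(* [1_0] is the real number 0 and tropical division is subtraction. *)
Definition tropical_inv g : R -> R := fun x => 0 - g x.

End TropicalFunctions.

Section TropicalProjectiveSpace.
Variables (R : realType) (m : nat).

(* R u {-oo} is the set of extended reals other than +oo. *)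
Definition tp_coord_pred (a : {ffun 'I_m.+1 -> \bar R}) : bool :=
  [forall i, a i != +oo%E] && [exists i, a i != -oo%E].

Definition tp_coord := {a : {ffun 'I_m.+1 -> \bar R} | tp_coord_pred a}.

Definition tp_rel (a b : tp_coord) : bool :=
  `[< exists l : R, forall i, val b i = (val a i + l%:E)%E >].

Lemma tp_rel_refl : reflexive tp_rel.
Proof. by move=> a; apply/asboolP; exists 0 => i; rewrite adde0. Qed.

Lemma tp_rel_imp_sym (a b : tp_coord) : tp_rel a b -> tp_rel b a.
Proof.
move=> /asboolP[l abl]; apply/asboolP; exists (- l) => i.
by rewrite abl EFinN addeK.
Qed.

Lemma tp_rel_sym : symmetric tp_rel.
Proof. by move=> a b; apply/idP/idP; exact: tp_rel_imp_sym. Qed.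

Lemma tp_rel_trans : transitive tp_rel.
Proof.
move=> b a c /asboolP[l ab] /asboolP[k bc]; apply/asboolP.
by exists (l + k) => i; rewrite bc ab EFinD addeA.
Qed.

Canonical tp_equiv := EquivRel tp_rel tp_rel_refl tp_rel_sym tp_rel_trans.

Definition tropical_projective_space := {eq_quot tp_equiv}%qT.

Lemma tp_coord_of_real_subproof (a : 'I_m.+1 -> R) :
  tp_coord_pred [ffun i => (a i)%:E].
Proof.
apply/andP; split; first by apply/forallP => i; rewrite ffunE.
by apply/existsP; exists ord0; rewrite ffunE.
Qed.

Definition tp_coord_of_real (a : 'I_m.+1 -> R) : tp_coord :=
  exist _ [ffun i => (a i)%:E] (tp_coord_of_real_subproof a).

(* [a_0 : ... : a_m] *)
Definition tp_point (a : 'I_m.+1 -> R) : tropical_projective_space :=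
  \pi_tropical_projective_space%qT (tp_coord_of_real a).

(* The tuple [F] gives homogeneous coordinates of the map [f]. *)
Definition represents (f : R -> tropical_projective_space)
    (F : 'I_m.+1 -> R -> R) : Prop :=
  [/\ forall i, tropical_entire (F i) \/ constant_fun (F i),
      exists i, ~ constant_fun (F i) &
      forall x, f x = tp_point (fun i => F i x)].

Definition tropical_holomorphic_curve (f : R -> tropical_projective_space) :=
  exists F, represents f F.

Definition reduced_representation (f : R -> tropical_projective_space)
    (F : 'I_m.+1 -> R -> R) : Prop :=
  represents f F /\ forall x, ~ (forall i, tropical_root (F i) x).

Implicit Type F : 'I_m.+1 -> R -> R.

(* Neither maximum is over an empty family; the default value of the iterated
   maximum is one of its terms. *)
Definition max_fun F (x : R) : R :=
  \big[Num.max/F ord0 x]_(i < m.+1) F i x.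

Definition nevanlinna_characteristic F (r : R) : R :=
  2^-1 * (max_fun F r + max_fun F (- r)) - max_fun F 0.

Definition shift_sum F (p : 'S_m.+1) (x : R) : R :=
  \sum_(i < m.+1) F i (x + (p i)%:R).

Definition casoratian F (x : R) : R :=
  \big[Num.max/shift_sum F 1%g x]_(p : 'S_m.+1) shift_sum F p x.

(* The values of [ln] at nonpositive reals, set to 0 by the library, matter only
   when the characteristic vanishes identically: it is a convex function of
   [r >= 0] vanishing at 0, so that otherwise it tends to +oo. In the degenerate
   case the components are affine with a common slope and the order is 0. *)
Definition hyper_order F : \bar R :=
  limf_esup
    (fun r : R => (ln (ln (nevanlinna_characteristic F r)) / ln r)%:E) +oo%R.

End TropicalProjectiveSpace.

Section ExceptionalSets.
Variable R : realType.

Definition finite_log_measure (E : set R) : Prop :=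
  [/\ measurable E, E `<=` `]0, +oo[ &
      (\int[lebesgue_measure]_(r in E `&` `[1%R, +oo[) (r^-1)%:E < +oo)%E].

(* The filter of "r tends to +oo with r outside E". *)
Definition pinfty_outside (E : set R) : filter_on R :=
  FilterType (within (~` E) +oo%R) (within_filter _ _).

End ExceptionalSets.

(* Main.v *)
Require Import Defs.
From HB Require Import structures.
From mathcomp Require Import all_boot all_order all_algebra.
From mathcomp Require Import all_classical all_reals all_analysis.
From mathcomp Require Import perm measurable_realfun.
From mathcomp Require Import ring lra.
Import Order.TTheory GRing.Theory Num.Theory.
Import numFieldNormedType.Exports.
Local Open Scope classical_set_scope.
Local Open Scope ring_scope.

(* Entire tropical functions are convex, and by the tropical Jensen formula
   N(r, 1_0 / g) is half of h_g(r) = g(r) + g(-r) - 2 g(0).  Both sides of the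
   claim are thus values of such second differences, of the F_i and of their
   Casoratian, which is again convex and piecewise linear.  For a convex g and a
   shift k <= m, the differences g(x + k) - g(x) at x = r and x = -r are at most
   h_g(r + m) - h_g(r) + O(1), so the two sides differ by S(r + m) - S(r) + O(1)
   with S the sum of the h_{F_i}.  As F_i <= max F, S is at most a multiple of T
   up to a constant, hence has hyper-order below 1 - sigma, and a Borel growth
   lemma for S + T makes its increment o(T / r^sigma) off a set of finite
   logarithmic measure.  The O(1) is absorbed because T is convex, hence at
   least linear, unless it vanishes; in that case S is bounded, so zero. *)

(** * Convex and piecewise linear functions *)

(** Convexity with denominators cleared, so that the degenerate cases [a = b] and [b = c] are
    harmless and linear arithmetic applies directly. *)
Definition chord_convex {R : realType} (g : R -> R) := forall a b c,
  a <= b -> b <= c -> (c - a) * g b <= (c - b) * g a + (b - a) * g c.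

Section ChordConvex.
Context {R : realType}.
Implicit Types g u v : R -> R.

Lemma chord_convexD u v : chord_convex u -> chord_convex v ->
  chord_convex (fun x => u x + v x).
Proof.
by move=> cu cv a b c ab bc; have := cu _ _ _ ab bc; have := cv _ _ _ ab bc; lra.
Qed.

Lemma chord_convex_cst (k : R) : chord_convex (fun=> k).
Proof. by move=> a b c _ _; lra. Qed.

Lemma chord_convex_max u v : chord_convex u -> chord_convex v ->
  chord_convex (fun x => Num.max (u x) (v x)).
Proof.
move=> cu cv a b c ab bc; have := cu _ _ _ ab bc; have := cv _ _ _ ab bc.
have [ua va] : u a <= Num.max (u a) (v a) /\ v a <= Num.max (u a) (v a).
  by rewrite !le_max !lexx orbT.
have [uc vc] : u c <= Num.max (u c) (v c) /\ v c <= Num.max (u c) (v c).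
  by rewrite !le_max !lexx orbT.
by have [_|_] := leP (u b) (v b); nra.
Qed.

Lemma chord_convex_shift g k : chord_convex g -> chord_convex (fun x => g (x + k)).
Proof.
move=> cg a b c ab bc; have := cg (a + k) (b + k) (c + k).
by rewrite !lerD2r => /(_ ab bc); lra.
Qed.

(** The points [x + k] and [y] lie at mirrored positions in [[x, y + k]], so their two chord
    inequalities add up to the claim times the length [y + k - x]. *)
Lemma chord_convex_increment g (x y k : R) : chord_convex g ->
  x <= y -> 0 <= k -> g (x + k) - g x <= g (y + k) - g y.
Proof.
move=> cg xy k0; have [yk|yk] := eqVneq (y + k) x.
  have -> : y = x by lra.
  by [].
have d0 : 0 < y + k - x by rewrite subr_gt0 lt_neqAle eq_sym yk; lra.
have h1 : (y + k - x) * g (x + k) <= (y - x) * g x + k * g (y + k).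
  by have := cg x (x + k) (y + k); lra.
have h2 : (y + k - x) * g y <= k * g x + (y - x) * g (y + k).
  by have := cg x y (y + k); lra.
rewrite -(ler_pM2l d0); lra.
Qed.

End ChordConvex.

(** * Second differences centred at the origin *)

Definition second_difference {R : realType} (g : R -> R) (r : R) :=
  g r + g (- r) - 2 * g 0.

Section SecondDifference.
Context {R : realType}.
Variable g : R -> R.
Hypothesis cg : chord_convex g.

(** Sum of the chord inequalities on [[0, r]] and [[- r, 0]]. It is the source of the linear lower
    bound on the characteristic. *)
Lemma second_difference_chord (r0 r : R) : 0 <= r0 -> r0 <= r ->
  r * second_difference g r0 <= r0 * second_difference g r.
Proof.
move=> r0_ge0 rr; rewrite /second_difference.
have := cg _ _ _ r0_ge0 rr.
have := cg (- r) (- r0) 0; rewrite lerN2 oppr_le0 => /(_ rr r0_ge0); lra.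
Qed.

(** By convexity the increment of [g] from [- y] to [- x] is at most the one from [x] to [y]. *)
Lemma second_difference_homo (x y : R) : 0 <= x -> x <= y ->
  second_difference g x <= second_difference g y.
Proof.
move=> x0 xy; rewrite /second_difference.
have yx : - y <= x by lra.
have k0 : 0 <= y - x by lra.
have := chord_convex_increment _ _ _ _ cg yx k0.
rewrite [- y + (y - x)](_ : _ = - x); last by lra.
by rewrite [x + (y - x)](_ : _ = y); lra.
Qed.

Lemma second_difference_ge0 (x : R) : 0 <= x -> 0 <= second_difference g x.
Proof.
move=> x0; have := second_difference_homo 0 x (lexx _) x0.
by rewrite /second_difference oppr0; lra.
Qed.

Lemma bounded_second_difference (M : R) :
  (forall x, 0 <= x -> second_difference g x <= M) ->
  forall x, 0 <= x -> second_difference g x = 0.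
Proof.
move=> gM x x0; apply/eqP; rewrite eq_le second_difference_ge0// andbT.
rewrite leNgt; apply/negP => h0.
have xN0 : x != 0.
  by apply/eqP => x00; move: h0; rewrite x00 /second_difference oppr0; lra.
have xp : 0 < x by rewrite lt_neqAle eq_sym xN0.
set h := second_difference g x in h0.
(* This [t] gives [t * h = h + M], so the value at [x * t] would exceed [M]. *)
pose t := 1 + M / h; have M0 : 0 < M by apply: lt_le_trans h0 _; exact: gM.
have t1 : 1 <= t by rewrite lerDl ltW// divr_gt0.
have xt : x <= x * t by rewrite ler_peMr.
have := second_difference_chord _ _ x0 xt.
rewrite -mulrA ler_pM2l// -/h => /le_trans/(_ (gM _ (le_trans x0 xt))).
by rewrite /t mulrDl mul1r divfK ?gt_eqF//; lra.
Qed.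

End SecondDifference.

(** * Germs of piecewise linear functions *)

Definition affine_germ {R : realType} (u : R -> R) :=
  exists e b : R, 0 < e /\ forall h, 0 <= h -> h <= e -> u h = u 0 + b * h.

(** The left side is read through the reflection [h -> g (x - h)], so that germs at [0] from the
    right serve both sides; the slope of the reflected germ is minus the left derivative. *)
Definition locally_piecewise_linear {R : realType} (g : R -> R) := forall x,
  affine_germ (fun h => g (x + h)) /\ affine_germ (fun h => g (x - h)).

Section LocallyPiecewiseLinear.
Context {R : realType}.
Implicit Types g u v : R -> R.

Lemma affine_germD u v : affine_germ u -> affine_germ v ->
  affine_germ (fun h => u h + v h).
Proof.
move=> [e [b [e0 ub]]] [f [c [f0 vc]]]; exists (Num.min e f), (b + c); split.
  by rewrite lt_min e0.
by move=> h h0; rewrite le_min => /andP[he hf]; rewrite ub// vc//; lra.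
Qed.

Lemma affine_germ_max u v : affine_germ u -> affine_germ v ->
  affine_germ (fun h => Num.max (u h) (v h)).
Proof.
wlog uv : u v / u 0 <= v 0.
  move=> wl gu gv; have [|/ltW vu] := leP (u 0) (v 0); first by move=> ?; exact: wl.
  by under eq_fun do rewrite maxC; exact: wl.
move=> [e [b [e0 ub]]] [f [c [f0 vc]]].
move: uv; rewrite le_eqVlt => /predU1P[uv|uv].
  exists (Num.min e f), (Num.max b c); split; first by rewrite lt_min e0.
  move=> h h0; rewrite le_min => /andP[he hf]; rewrite ub// vc// uv maxxx.
  by rewrite maxr_pMl// addr_maxr.
(* For [h <= d] the difference of slopes cannot close the gap [v 0 - u 0]; the summand 1 avoids a
   division by zero. *)
pose d := (v 0 - u 0) / (1 + `|b - c|).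
have n0 : 0 < 1 + `|b - c| by rewrite ltr_wpDr.
have d0 : 0 < d by rewrite divr_gt0// subr_gt0.
exists (Num.min d (Num.min e f)), c; split; first by rewrite !lt_min d0 e0.
move=> h h0; rewrite !le_min => /and3P[hd he hf].
rewrite [Num.max (u 0) _]max_r ?(ltW uv)// max_r; first by rewrite vc.
rewrite ub// vc//; have : h * (1 + `|b - c|) <= v 0 - u 0 by rewrite -ler_pdivlMr.
have : (b - c) * h <= `|b - c| * h by rewrite ler_wpM2r// ler_norm.
lra.
Qed.

Lemma affine_germ_cst (k : R) : affine_germ (fun=> k).
Proof. by exists 1, 0; split=> // h _ _; lra. Qed.

Lemma locally_piecewise_linearD u v : locally_piecewise_linear u ->
  locally_piecewise_linear v -> locally_piecewise_linear (fun x => u x + v x).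
Proof.
by move=> lu lv x; have [? ?] := lu x; have [? ?] := lv x; split; exact: affine_germD.
Qed.

Lemma locally_piecewise_linear_max u v : locally_piecewise_linear u ->
  locally_piecewise_linear v ->
  locally_piecewise_linear (fun x => Num.max (u x) (v x)).
Proof.
by move=> lu lv x; have [? ?] := lu x; have [? ?] := lv x; split; exact: affine_germ_max.
Qed.

Lemma locally_piecewise_linear_cst (k : R) : locally_piecewise_linear (fun=> k).
Proof. by move=> x; split; exact: affine_germ_cst. Qed.

Lemma locally_piecewise_linear_shift g k : locally_piecewise_linear g ->
  locally_piecewise_linear (fun x => g (x + k)).
Proof.
move=> lg x; have [lgr lgl] := lg (x + k); split.
  by under eq_fun do rewrite addrAC.
by under eq_fun do rewrite addrAC.
Qed.

Lemma big_max_closed (Q : (R -> R) -> Prop) (I : Type) (s : seq I)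
    (F : I -> R -> R) (f0 : R -> R) :
  (forall u v, Q u -> Q v -> Q (fun x => Num.max (u x) (v x))) ->
  Q f0 -> (forall i, Q (F i)) -> Q (fun x => \big[Num.max/f0 x]_(i <- s) F i x).
Proof.
move=> Qmax Q0 QF; elim: s => [|i s IHs]; first by under eq_fun do rewrite big_nil.
by under eq_fun do rewrite big_cons; exact: Qmax.
Qed.

Lemma big_sum_closed (Q : (R -> R) -> Prop) (I : Type) (s : seq I)
    (F : I -> R -> R) :
  (forall u v, Q u -> Q v -> Q (fun x => u x + v x)) -> Q (fun=> 0) ->
  (forall i, Q (F i)) -> Q (fun x => \sum_(i <- s) F i x).
Proof.
move=> QD Q0 QF; elim: s => [|i s IHs]; first by under eq_fun do rewrite big_nil.
by under eq_fun do rewrite big_cons; exact: QD.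
Qed.

(** As [x] is no limit point of [B], a punctured neighbourhood of [x] misses [B]; [g] is affine on
    each half of it, and by continuity up to [x]. *)
Lemma piecewise_linear_locally g : continuous g -> piecewise_linear g ->
  locally_piecewise_linear g.
Proof.
move=> gc [B B0 gB] x.
have [U [xU UB]] : exists U : set R, nbhs x U /\ forall y, U y -> B y -> y = x.
  have : ~ limit_point B x by rewrite B0.
  move=> /existsNP[U /not_implyP[xU /forallNP nU]]; exists U; split => // y Uy By.
  by apply/eqP/negP => /negP yx; apply: (nU y).
move: xU => /nbhs_ballP[d /= d0 dU].
have key (a b : R) : a < b -> `]a, b[ `&` B = set0 -> exists s : R,
    forall y z, a <= y <= b -> a <= z <= b -> g y - g z = s * (y - z).
  move=> ab /gB[s [c gsc]]; exists s.
  suff gE y : a <= y <= b -> g y = s * y + c.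
    by move=> y z /gE-> /gE->; lra.
  (* At an endpoint [u], along a one-sided filter, [g] tends to [g u] by continuity and to
     [s * u + c] by the formula. *)
  have h (u : R) (G : set_system R) : ProperFilter G -> G --> u ->
      (\forall t \near G, t \in `]a, b[) -> g u = s * u + c.
    move=> pG Gu Gab; apply: (@cvg_unique _ (@Rhausdorff R) (g @ G)).
      by apply: cvg_trans (gc u); exact: cvg_app.
    have : (fun t => s * t + c) @ G --> s * u + c.
      by apply: cvgD; [exact: cvgMr|exact: cvg_cst].
    by apply: cvg_trans; apply: near_eq_cvg; near do rewrite gsc//.
  move=> /andP[]; rewrite le_eqVlt => /predU1P[<- _|ay].
    apply: (h a (a^'+)); first exact: cvg_at_right_filter.
    near=> t; rewrite in_itv/=; apply/andP; split; near: t.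
      exact: nbhs_right_gt.
    exact: nbhs_right_lt.
  rewrite le_eqVlt => /predU1P[->|yb].
    apply: (h b (b^'-)); first exact: cvg_at_left_filter.
    near=> t; rewrite in_itv/=; apply/andP; split; near: t.
      exact: nbhs_left_gt.
    exact: nbhs_left_lt.
  by rewrite gsc// in_itv/= ay.
have [s1 gs1] : exists s : R, forall y z, x <= y <= x + d -> x <= z <= x + d ->
    g y - g z = s * (y - z).
  apply: key; first by lra.
  rewrite -subset0 => t [/= /[!in_itv]/= /andP[xt tx] Bt].
  have := xt; rewrite (UB t)// ?ltxx//; apply: dU.
  by rewrite /ball/= ltr_distlC; apply/andP; split; lra.
have [s2 gs2] : exists s : R, forall y z, x - d <= y <= x -> x - d <= z <= x ->
    g y - g z = s * (y - z).
  apply: key; first by lra.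
  rewrite -subset0 => t [/= /[!in_itv]/= /andP[xt tx] Bt].
  have := tx; rewrite (UB t)// ?ltxx//; apply: dU.
  by rewrite /ball/= ltr_distlC; apply/andP; split; lra.
split.
  exists d, s1; split => // h h0 hd.
  by have := gs1 (x + h) (x + 0); lra.
exists d, (- s2); split => // h h0 hd.
by have := gs2 (x - h) (x - 0); lra.
Unshelve. all: by end_near. Qed.

End LocallyPiecewiseLinear.

(** * Jensen formula *)

Local Lemma minl_le {R : realType} (x y : R) : Num.min x y <= x.
Proof. by rewrite ge_min lexx. Qed.

Local Lemma minr_le {R : realType} (x y : R) : Num.min x y <= y.
Proof. by rewrite ge_min lexx orbT. Qed.

(** Continuous induction: the supremum of the [t] with [P a t] is attained by the local hypothesis
    on its left, and equals [b] by the one on its right. *)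
Lemma interval_induction {R : realType} (P : R -> R -> Prop) :
  (forall a b c, a < c -> c < b -> P a c -> P c b -> P a b) ->
  (forall x, exists2 e, 0 < e & (forall u, x - e <= u -> u < x -> P u x) /\
                                (forall v, x < v -> v <= x + e -> P x v)) ->
  forall a b, a < b -> P a b.
Proof.
move=> Padd Ploc a b ab.
pose S := [set t | [/\ a < t, t <= b & P a t]].
have [e e0 [_ Pa]] := Ploc a.
have Sm : S (Num.min (a + e) b).
  have lt_am : a < Num.min (a + e) b by rewrite lt_min ab ltrDl e0.
  by split => //; [exact: minr_le|apply: Pa => //; exact: minl_le].
have supS : has_sup S by split; [exists (Num.min (a + e) b)|exists b => t []].
have aS : a < sup S.
  by apply: lt_le_trans (sup_ubound (proj2 supS) Sm); rewrite lt_min ab ltrDl e0.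
have Sb : sup S <= b by apply: ge_sup; [exists (Num.min (a + e) b)|move=> t []].
have [d d0 [Pl Pr]] := Ploc (sup S).
have PS : P a (sup S).
  have [t [at_ tb Pt] dt] := sup_adherent d0 supS.
  have : t <= sup S by apply: (sup_ubound (proj2 supS)).
  rewrite le_eqVlt => /predU1P[<-//|tS].
  by apply: (Padd _ _ t) => //; apply: Pl => //; exact: ltW.
move: Sb; rewrite le_eqVlt => /predU1P[<-//|Sb].
set v := Num.min (sup S + d) b.
have Sv : sup S < v by rewrite lt_min Sb ltrDl d0.
suff : v <= sup S by rewrite leNgt Sv.
apply: (sup_ubound (proj2 supS)); split; first exact: lt_trans Sv.
  exact: minr_le.
by apply: (Padd _ _ (sup S)) => //; apply: Pr => //; exact: minl_le.
Qed.

Section Slopes.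
Context {R : realType}.
Implicit Types g : R -> R.

Lemma right_derivative_affine g x e b : 0 < e ->
  (forall h, 0 <= h -> h <= e -> g (x + h) = g x + b * h) ->
  right_derivative g x = b.
Proof.
move=> e0 gb; apply: lim_near_cst; first exact: Rhausdorff.
near=> h; have h0 : 0 < h by near: h; exact: nbhs_right_gt.
have he : h <= e by near: h; exact: nbhs_right_ltW.
by rewrite gb ?ltW// addrAC subrr add0r mulrC mulfK// gt_eqF.
Unshelve. all: by end_near. Qed.

Lemma left_derivative_affine g x e a : 0 < e ->
  (forall h, 0 <= h -> h <= e -> g (x - h) = g x - a * h) ->
  left_derivative g x = a.
Proof.
move=> e0 gb; apply: lim_near_cst; first exact: Rhausdorff.
near=> h; have h0 : h < 0 by near: h; exact: nbhs_left_lt.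
have he : - e < h by near: h; apply: nbhs_left_gt; rewrite oppr_lt0.
have [h1 h2] : 0 <= - h /\ - h <= e by lra.
by rewrite -[h in g (x + h)]opprK gb// addrAC subrr add0r !mulrN opprK mulrC mulfK// lt_eqF.
Unshelve. all: by end_near. Qed.

Lemma omegaN g x : locally_piecewise_linear g -> omega (fun y => - g y) x = - omega g x.
Proof.
move=> /(_ x)[[e [b [e0 gb]]] [f [a [f0 ga]]]].
have gb' h : 0 <= h -> h <= e -> g (x + h) = g x + b * h by move/gb/[apply]; rewrite addr0.
have ga' h : 0 <= h -> h <= f -> g (x - h) = g x - (- a) * h.
  by move/ga/[apply]; rewrite subr0 mulNr opprK.
rewrite /omega (right_derivative_affine g x e b)// (left_derivative_affine g x f (- a))//.
rewrite (right_derivative_affine _ x e (- b))//; last first.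
  by move=> h h0 he; rewrite gb'// mulNr opprD.
rewrite (left_derivative_affine _ x f a)//; first by lra.
by move=> h h0 he; rewrite ga'// mulNr opprK opprD.
Qed.

Lemma chord_convex_omega_ge0 g x : locally_piecewise_linear g -> chord_convex g ->
  0 <= omega g x.
Proof.
move=> /(_ x)[[e [b [e0 gb]]] [f [a [f0 ga]]]] cg.
have gb' h : 0 <= h -> h <= e -> g (x + h) = g x + b * h by move/gb/[apply]; rewrite addr0.
have ga' h : 0 <= h -> h <= f -> g (x - h) = g x - (- a) * h.
  by move/ga/[apply]; rewrite subr0 mulNr opprK.
rewrite /omega (right_derivative_affine g x e b)// (left_derivative_affine g x f (- a))//.
pose d := Num.min e f; have d0 : 0 < d by rewrite lt_min e0.
have gr := gb' _ (ltW d0) (minl_le _ _); have gl := ga' _ (ltW d0) (minr_le _ _).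
have : (x + d - (x - d)) * g x <=
    (x + d - x) * g (x - d) + (x - (x - d)) * g (x + d) by apply: cg; lra.
(* Convexity on [[x - d, x + d]] reads [0 <= d * (d * omega g x)]. *)
by rewrite gr gl => H; rewrite -(pmulr_rge0 _ d0) -(pmulr_rge0 _ d0); lra.
Qed.

(* Summation by parts for the Stieltjes integral of an affine weight against dg'. *)
Lemma sum_omega_affine g (a b : R) : locally_piecewise_linear g -> a < b ->
  exists s : seq R, [/\ uniq s,
    forall z, z \in s = (a < z < b) && (omega g z != 0) &
    forall p q, \sum_(z <- s) omega g z * (p * z + q) =
      (p * b + q) * left_derivative g b - (p * a + q) * right_derivative g a -
      p * (g b - g a)].
Proof.
move=> lg; move: a b; apply: interval_induction => [a b c ac cb|x].
  move=> [s1 [us1 ms1 es1]] [s2 [us2 ms2 es2]].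
  (* The cut point [c] is interior to []a, b[]; it is listed only if [g] bends there. Its term
     supplies the jump between the boundary terms of the two halves. *)
  pose mid := [seq z <- [:: c] | omega g z != 0].
  have mmid z : z \in mid = (omega g z != 0) && (z == c) by rewrite mem_filter inE.
  have umid : uniq mid by rewrite filter_uniq.
  exists (s1 ++ (mid ++ s2)); split.
  - rewrite cat_uniq us1 cat_uniq umid us2 !andTb andbT; apply/andP; split.
      apply/hasPn => z; rewrite mem_cat mmid ms2 /= ms1.
      move=> /orP[/andP[_ /eqP->]|/andP[/andP[cz _] _]]; first by rewrite ltxx andbF.
      by rewrite [z < c]ltNge (ltW cz) andbF.
    apply/hasPn => z; rewrite ms2 /= mmid => /andP[/andP[cz _] _].
    by rewrite (gt_eqF cz) andbF.
  - move=> z; rewrite !mem_cat mmid ms1 ms2.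
    have [zc|cz|->] := ltgtP z c; rewrite ?andbF ?orbF ?andbT/=.
    + by rewrite (lt_trans zc cb) andbT.
    + by rewrite (lt_trans ac cz).
    + by rewrite ac cb.
  - move=> p q; rewrite !big_cat/= es1 es2 big_filter big_cons big_nil.
    have -> : (if omega g c != 0 then omega g c * (p * c + q) + 0 else 0) =
        omega g c * (p * c + q).
      by case: eqP => [->|_]; rewrite /= ?mul0r ?addr0.
    by rewrite /omega; lra.
have [[e [b [e0 gb]]] [f [a [f0 ga]]]] := lg x.
have gb' h : 0 <= h -> h <= e -> g (x + h) = g x + b * h by move/gb/[apply]; rewrite addr0.
have ga' h : 0 <= h -> h <= f -> g (x - h) = g x - (- a) * h.
  by move/ga/[apply]; rewrite subr0 mulNr opprK.
(* Where [g] is affine up to the endpoints there is nothing to list, and the boundary terms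
   cancel. *)
have affine_omega u v k : u < v ->
    (forall y z, u <= y <= v -> u <= z <= v -> g z = g y + k * (z - y)) ->
  exists s : seq R, [/\ uniq s,
    forall z, z \in s = (u < z < v) && (omega g z != 0) &
    forall p q, \sum_(z <- s) omega g z * (p * z + q) =
      (p * v + q) * left_derivative g v - (p * u + q) * right_derivative g u -
      p * (g v - g u)].
  move=> uv guv.
  have rd y : u <= y < v -> right_derivative g y = k.
    move=> /andP[uy yv]; apply: (right_derivative_affine g y (v - y)); first lra.
    move=> h h0 hv; rewrite (guv y (y + h)); [lra| |].
      by apply/andP; split; lra.
    by apply/andP; split; lra.
  have ld y : u < y <= v -> left_derivative g y = k.
    move=> /andP[uy yv]; apply: (left_derivative_affine g y (y - u)); first lra.
    move=> h h0 hv; rewrite (guv y (y - h)); [lra| |].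
      by apply/andP; split; lra.
    by apply/andP; split; lra.
  exists [::]; split=> // [z|p q].
    apply/esym/negP => /andP[/andP[uz zv]] /negP; apply; rewrite /omega.
    by rewrite rd ?(ltW uz)// ld ?uz ?(ltW zv)// subrr.
  by rewrite big_nil ld ?uv ?lexx// rd ?uv ?lexx// (guv u v) ?lexx ?(ltW uv)//; lra.
exists (Num.min e f); first by rewrite lt_min e0.
split=> [u|v] xu ux.
  apply: (affine_omega u x (- a)) => // y z /andP[uy yx] /andP[uz zx].
  have [xe xf] : Num.min e f <= e /\ Num.min e f <= f by rewrite !ge_min !lexx orbT.
  have gy : g (x - (x - y)) = g x - - a * (x - y) by apply: ga'; lra.
  have gz : g (x - (x - z)) = g x - - a * (x - z) by apply: ga'; lra.
  by move: gy gz; rewrite !subKr => -> ->; lra.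
apply: (affine_omega x v b) => // y z /andP[uy yx] /andP[uz zx].
have [xe xf] : Num.min e f <= e /\ Num.min e f <= f by rewrite !ge_min !lexx orbT.
have gy : g (x + (y - x)) = g x + b * (y - x) by apply: gb'; lra.
have gz : g (x + (z - x)) = g x + b * (z - x) by apply: gb'; lra.
by move: gy gz; rewrite !(addrC x) !subrK => -> ->; lra.
Qed.

(* With the weights z - a and b - z, summation by parts bounds the chord slopes
   on either side of a point by its one-sided derivatives. *)
Lemma omega_ge0_chord_convex g : locally_piecewise_linear g ->
  (forall x, 0 <= omega g x) -> chord_convex g.
Proof.
move=> lg g0 a b c; rewrite le_eqVlt => /predU1P[->|ab].
  by move=> _; lra.
rewrite le_eqVlt => /predU1P[->|bc]; first by lra.
have [s [us ms es]] := sum_omega_affine g a b lg ab.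
have [t [ut mt et]] := sum_omega_affine g b c lg bc.
have := es 1 (- a); have := et (-1) c.
have : 0 <= \sum_(z <- s) omega g z * (1 * z - a).
  rewrite big_seq; apply: sumr_ge0 => z; rewrite ms => /andP[/andP[az _] _].
  by rewrite mulr_ge0// mul1r subr_ge0 ltW.
have : 0 <= \sum_(z <- t) omega g z * (-1 * z + c).
  rewrite big_seq; apply: sumr_ge0 => z; rewrite mt => /andP[/andP[_ zc] _].
  by rewrite mulr_ge0// mulN1r addrC subr_ge0 ltW.
move=> + + ht hs; rewrite ht hs => h1 h2.
have := g0 b; rewrite /omega => h3.
have [cb ba] : 0 < c - b /\ 0 < b - a by lra.
(* The one-sided derivatives at [b] cancel in [h4 + h5 + h6], which leaves the chord inequality. *)
have h4 : 0 <= (c - b) * ((b - a) * left_derivative g b - (g b - g a)).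
  by apply: mulr_ge0; lra.
have h5 : 0 <= (b - a) * ((g c - g b) - (c - b) * right_derivative g b).
  by apply: mulr_ge0; lra.
have h6 : 0 <= (c - b) * (b - a) * (right_derivative g b - left_derivative g b).
  by rewrite !mulr_ge0// ltW.
lra.
Qed.

(** Tropical Jensen formula. The weight [r - |z|] is affine on each side of 0, so summation by parts
    applies twice: the derivatives at [r] and [- r] carry weight 0, and those at 0 cancel against
    the term of 0 itself. *)
Lemma counting_function_second_difference g r : locally_piecewise_linear g ->
  (forall x, 0 <= omega g x) -> 0 < r ->
  counting_function r (tropical_inv g) = 2^-1 * second_difference g r.
Proof.
move=> lg g0 r0.
have om z : omega (tropical_inv g) z = - omega g z.
  by rewrite -omegaN// /tropical_inv; under eq_fun do rewrite sub0r.
have rN : - r < 0 by lra.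
have [s [us ms es]] := sum_omega_affine g (- r) 0 lg rN.
have [t [ut mt et]] := sum_omega_affine g 0 r lg r0.
rewrite /counting_function; congr (_ * _).
(* The point 0 is listed even if its [omega] vanishes, in which case it contributes 0. *)
pose l := s ++ [:: 0] ++ t.
have ul : uniq l.
  rewrite cat_uniq us /= ut mt ms !ltxx !andbF /= andbT; apply/hasPn => z.
  by rewrite /= mt ms => /andP[/andP[z0 _] _]; rewrite [z < 0]ltNge (ltW z0) andbF.
pose w z := `|omega (tropical_inv g) z| * (r - `|z|).
have wE z : w z = omega g z * (r - `|z|) by rewrite /w om normrN ger0_norm.
transitivity (\sum_(z <- l) w z); last first.
  rewrite /l !big_cat big_cons big_nil /= wE normr0.
  have -> : \sum_(z <- s) w z = \sum_(z <- s) omega g z * (1 * z + r).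
    rewrite !big_seq; apply: eq_bigr => z; rewrite ms => /andP[/andP[_ z0] _].
    by rewrite wE ltr0_norm// opprK mul1r addrC.
  have -> : \sum_(z <- t) w z = \sum_(z <- t) omega g z * (-1 * z + r).
    rewrite !big_seq; apply: eq_bigr => z; rewrite mt => /andP[/andP[z0 _] _].
    by rewrite wE gtr0_norm// mulN1r addrC.
  by rewrite es et /omega /second_difference; lra.
pose A := [set z | tropical_pole (tropical_inv g) z /\ z \in `]- r, r[].
have AE z : A z <-> [/\ 0 < omega g z, - r < z & z < r].
  rewrite /A/= /tropical_pole om oppr_lt0 in_itv/=.
  by split=> [[oz /andP[]]|[oz rz zr]]; split=> //; apply/andP.
have Al z : A z -> z \in l.
  move=> /AE[oz rz zr]; rewrite !mem_cat inE ms mt rz zr (gt_eqF oz) !andbT.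
  by case: (ltgtP z 0).
(* Points of [l] outside [A] have zero [omega], so the sum over [l] agrees with the finitely
   supported sum over [A]. *)
rewrite (@fsbigE _ _ _ _ A [seq z <- l | z \in A]) ?filter_uniq//; last 2 first.
- by move=> z /=; rewrite mem_filter => /andP[/set_mem].
- by move=> z Az; rewrite mem_filter Al// andbT mem_set.
rewrite big_filter_cond [RHS]big_mkcond [LHS]big_mkcond/=; apply: eq_big_seq => z zl.
rewrite andbb; case: ifPn => // /negP zA; rewrite wE.
suff /eqP-> : omega g z == 0 by rewrite mul0r.
apply/negP => /negP oz; apply: zA; apply/mem_set/AE; rewrite lt_neqAle eq_sym oz g0; split=> //.
- move: zl; rewrite !mem_cat inE ms mt => /or3P[|/eqP->|] //; first by case/andP=> /andP[].
  by move=> /andP[/andP[/(lt_trans rN)]].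
- move: zl; rewrite !mem_cat inE ms mt => /or3P[|/eqP->|] //; last by case/andP=> /andP[].
  by move=> /andP[/andP[_ /lt_trans->]].
Qed.

End Slopes.

(** * Growth outside an exceptional set *)

Section Growth.
Context {R : realType}.

(** On [[n, n + 1[] the density [r^-1] is at most [n^-1], so the logarithmic measure is at most the
    sum of the [n^-1] with [D n]. *)
Lemma finite_log_measure_bigcup (D : pred nat) (M : R) :
  (forall n, D n -> (0 < n)%N) ->
  (forall N, \sum_(0 <= n < N | D n) n%:R^-1 <= M) ->
  finite_log_measure (\bigcup_(n in [set n | D n]) `[n%:R, n.+1%:R[%classic : set R).
Proof.
move=> D0 DM; set E := \bigcup_(n in _) _.
pose G n : set R := if D n then `[n%:R, n.+1%:R[%classic else set0.
have EG : E = \bigcup_n G n.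
  apply/seteqP; split=> [x [n Dn nx]|x [n _]].
    by exists n => //; rewrite /G ifT.
  by rewrite /G; case: ifPn => // Dn nx; exists n.
have mG n : measurable (G n) by rewrite /G; case: ifP => _; [exact: measurable_itv|].
have mE : measurable E by rewrite EG; exact: bigcup_measurable.
have E1 : E `<=` `[1, +oo[.
  move=> x [n /D0 n0] /=; rewrite !in_itv/= andbT => /andP[nx _].
  by rewrite (le_trans _ nx)// ler1n.
(* On [[1, +oo[] the inverse coincides with the power of exponent -1, whose measurability is
   available. *)
have minv (A : set R) : measurable A -> A `<=` `[1, +oo[ ->
    measurable_fun A (fun r : R => (r^-1)%:E).
  move=> mA A1; apply/measurable_EFinP.
  apply: (eq_measurable_fun (fun r => r `^ (-1))).
    move=> x /set_mem/A1/=; rewrite in_itv/= andbT => x1.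
    by rewrite powR_inv1// (le_trans _ x1).
  by apply: (measurable_funS measurableT) => //; exact: measurable_powR.
have inv0 x : E x -> (0 <= (x^-1)%:E)%E.
  by move=> /E1/=; rewrite in_itv/= andbT lee_fin invr_ge0; apply: le_trans.
split => //; first by move=> x /E1/=; rewrite !in_itv/= !andbT; apply: lt_le_trans.
rewrite (setIidl E1) EG ge0_integral_bigcup//; last 3 first.
- by rewrite -EG; exact: minv.
- by move=> x Ex; apply: inv0; rewrite EG.
- move=> i j _ _ [x []]; rewrite /G; case: ifP => // _; case: ifP => // _ /=.
  rewrite !in_itv/= => /andP[ix xi] /andP[jx xj].
  have := le_lt_trans ix xj; have := le_lt_trans jx xi.
  by rewrite !ltr_nat !ltnS => h1 h2; apply/eqP; rewrite eqn_leq h1 h2.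
have GE n : G n `<=` E by move=> x Gx; rewrite EG; exists n.
have intG n : (\int[lebesgue_measure]_(x in G n) (x^-1)%:E <=
    (if D n then n%:R^-1 else 0)%:E)%E.
  case: ifPn => Dn; last by rewrite /G (negbTE Dn) integral_set0.
  have GnE : G n = `[n%:R, n.+1%:R[%classic by rewrite /G Dn.
  apply: (@le_trans _ _ (\int[lebesgue_measure]_(x in G n) (cst (n%:R^-1)%:E x))%E).
    apply: ge0_le_integral => //.
    - exact: mG.
    - by move=> x Gx; exact: inv0 _ (GE n x Gx).
    - by apply: minv; [exact: mG|move=> x Gx]; exact: E1 _ (GE n x Gx).
    - move=> x; rewrite GnE/= in_itv/= lee_fin => /andP[nx _].
      by rewrite lef_pV2// posrE ?ltr0n ?D0//; apply: lt_le_trans nx; rewrite ltr0n D0.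
  have mu1 : lebesgue_measure (`[n%:R, n.+1%:R[%classic : set R) = 1%E.
    by rewrite lebesgue_measure_itv/= lte_fin ltr_nat ltnSn -EFinB -natrB// subSnn.
  rewrite integral_cst ?GnE; last exact: measurable_itv.
  by rewrite [X in (_ * X <= _)%E](_ : _ = 1%E)// mule1.
apply: (@le_lt_trans _ _ M%:E); last exact: ltry.
apply: lime_le.
  apply: is_cvg_nneseries => n _ _; apply: integral_ge0 => x Gx; exact: inv0 _ (GE n x Gx).
apply: nearW => N.
apply: (@le_trans _ _ (\sum_(0 <= n < N) (if D n then n%:R^-1 else 0)%:E)%E).
  by apply: lee_sum => n _; exact: intG.
by rewrite sumEFin lee_fin -big_mkcond.
Qed.

Lemma powR_near_pinfty (t M : R) : 0 < t -> \forall r \near +oo%R, M <= r `^ t.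
Proof.
move=> t0; near=> r.
have M1 : 0 <= Num.max M 1 by rewrite le_max ler01 orbT.
have r1 : Num.max M 1 `^ t^-1 <= r by near: r; exact: nbhs_pinfty_ge.
apply: (@le_trans _ _ ((Num.max M 1 `^ t^-1) `^ t)).
  by rewrite -powRrM mulVf ?gt_eqF// powRr1// le_max lexx.
by rewrite ge0_ler_powR ?nnegrE ?powR_ge0 ?(ltW t0)// (le_trans _ r1)// powR_ge0.
Unshelve. all: by end_near. Qed.

(** From [exp v <= 1 / (1 - v) <= 1 + 2 v] on [[0, 1/2]]. *)
Lemma expR_le_half (v : R) : v <= 2^-1 -> 0 <= v -> expR v - 1 <= 2 * v.
Proof.
move=> v2 v0; have v1 : 0 < 1 - v by lra.
have := expR_ge1Dx (- v); rewrite expRN => h.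
have : expR v * (1 - v) <= 1.
  by rewrite -ler_pdivlMl ?expR_gt0// mulr1.
have : 1 <= (1 + 2 * v) * (1 - v) by nra.
move=> h1 h2; have := le_trans h2 h1; rewrite ler_pM2r//; lra.
Qed.

(** Since [t ^ (- c)] has derivative [- c * t ^ (- 1 - c)], a drop below [x] between [ln a] and
    [ln b] forces [ln b - ln a] to be of order [x * ln a ^ (1 + c) / c]. The two smallness
    hypotheses allow the exponentials to be linearized; each of the three linearizations costs a
    factor 2, whence the 8. *)
Lemma small_potential_drop (c x a b : R) : 0 < c -> 0 < x -> expR 1 <= a -> a <= b ->
  ln a `^ (- c) - ln b `^ (- c) < x ->
  x * ln a `^ (1 + c) <= 2^-1 -> x * ln a `^ (1 + c) <= c / 8 ->
  b - a <= 8 / c * (x * ln a `^ (1 + c)) * a.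
Proof.
move=> c0 x0 ea ab drop small1 small2.
have a0 : 0 < a by apply: lt_le_trans ea; exact: expR_gt0.
have b0 : 0 < b by exact: lt_le_trans ab.
set A := ln a in drop small1 small2 *; set B := ln b in drop.
have A1 : 1 <= A by rewrite -[1](@expRK R) ler_ln// posrE expR_gt0.
have A0 : 0 < A by exact: lt_le_trans A1.
have AB : A <= B by rewrite ler_ln.
have B0 : 0 < B by exact: lt_le_trans AB.
have aE : a = expR A by rewrite lnK.
have bE : b = expR B by rewrite lnK.
set v := ln (B / A).
have v0 : 0 <= v by apply: ln_ge0; rewrite ler_pdivlMr// mul1r.
have BE : B = A * expR v by rewrite lnK ?posrE ?divr_gt0// mulrC divfK// gt_eqF.
have BcE : B `^ (- c) = A `^ (- c) * expR (- (c * v)).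
  rewrite BE powRM ?expR_ge0 ?ltW//; congr (_ * _).
  by rewrite /powR gt_eqF ?expR_gt0// expRK mulNr.
set y := x * A `^ c.
have Ac0 : 0 < A `^ c by exact: powR_gt0.
have yle : y <= x * A `^ (1 + c).
  by rewrite /y ler_wpM2l ?(ltW x0)//; apply: ler_powR => //; lra.
have xAE : x * A `^ (1 + c) = A * y.
  by rewrite powRD ?powRr1 ?ltW// ?(gt_eqF A0) ?implybT// /y mulrCA.
have y0 : 0 < y by rewrite mulr_gt0.
have drop' : 1 - expR (- (c * v)) < y.
  move: drop; rewrite BcE -{1}[A `^ (- c)]mulr1 -mulrBr powRN.
  by rewrite mulrC ltr_pdivrMr.
set u := c * v in drop'.
have u0 : 0 <= u by rewrite mulr_ge0// ltW.
have eu : u * expR (- u) <= 1 - expR (- u).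
  have := expR_ge1Dx u => h.
  have : (1 + u) * expR (- u) <= expR u * expR (- u) by rewrite ler_wpM2r// expR_ge0.
  by rewrite -expRD subrr expR0; lra.
(* As [y <= 1/2], the drop bound gives [exp (- u) >= 1/2], and [u * exp (- u) < y]. *)
have u2 : u <= 2 * y.
  have e2 : 2^-1 <= expR (- u) by lra.
  have : u * 2^-1 <= u * expR (- u) by rewrite ler_wpM2l.
  lra.
have vy : v <= 2 / c * y.
  by rewrite mulrAC ler_pdivlMr// mulrC.
have cy : 8 / c * (A * y) <= 1.
  by rewrite mulrAC ler_pdivrMr// -xAE; lra.
have Ay : y <= A * y by rewrite ler_peMl// ltW.
have ic : 0 < c^-1 by rewrite invr_gt0.
have icy : c^-1 * y <= c^-1 * (A * y) by rewrite ler_pM2l.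
have v2 : v <= 2^-1 by lra.
have BA : B - A <= 4 / c * (A * y).
  have := expR_le_half v v2 v0 => h.
  have : A * (expR v - 1) <= A * (2 * v) by rewrite ler_wpM2l// (ltW A0).
  have : A * v <= A * (2 / c * y) by rewrite ler_wpM2l// (ltW A0).
  rewrite BE; lra.
have BA2 : B - A <= 2^-1 by lra.
have BA0 : 0 <= B - A by lra.
have := expR_le_half _ BA2 BA0; rewrite xAE => h.
have -> : b - a = (expR (B - A) - 1) * a.
  by rewrite mulrBl mul1r {2}aE -expRD subrK -bE.
by apply: ler_wpM2r; [exact: ltW|lra].
Qed.

(** Terms at distance [q] cancel; at most the first [q] values survive on the positive side. *)
Lemma telescoping_drop (phi : nat -> R) (q N : nat) : (forall n, 0 <= phi n) ->
  \sum_(n < N) (phi n - phi (q + n)%N) <= \sum_(n < q) phi n.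
Proof.
move=> phi0; rewrite sumrB lerBlDr.
have -> : \sum_(n < q) phi n + \sum_(n < N) phi (q + n)%N = \sum_(n < q + N) phi n.
  by rewrite big_split_ord.
by rewrite addnC big_split_ord/= lerDl sumr_ge0.
Qed.

(* The discrete Borel argument: [n] is exceptional when the potential
   (ln W)^(-c) drops by at least 1/n between [n] and [n + p + 1]; the total drop
   is finite, and this bounds the logarithmic measure. *)
Lemma increment_small_outside (W : R -> R) (p : nat) (rho sigma K : R) :
  (forall x y, 0 <= x -> x <= y -> W x <= W y) ->
  (forall x, 0 <= x -> expR 1 <= W x) ->
  0 < rho -> 0 < sigma -> rho + sigma < 1 -> 0 <= K ->
  (\forall r \near +oo%R, ln (W r) <= K * r `^ rho) ->
  exists2 E : set R, finite_log_measure E &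
    forall eps, 0 < eps -> \forall r \near +oo%R, ~ E r ->
      W (r + p%:R) - W r <= eps * (W r / r `^ sigma).
Proof.
move=> Wh We rho0 sigma0 rs1 K0 WK.
pose tau := 1 - rho - sigma; have tau0 : 0 < tau by rewrite /tau; lra.
(* This makes [rho * (1 + c) = 1 - sigma - tau / 2]: beyond the required [r ^ sigma], a factor
   [r ^ (tau / 2)] is left to absorb constants. *)
pose c := tau / (2 * rho); have c0 : 0 < c by rewrite divr_gt0// mulr_gt0.
(* One more than [p]: for [r] in [[n, n + 1[] the interval [[r, r + p]] lies in [[n, n + q]]. *)
pose q := p.+1; pose phi n := ln (W n%:R) `^ (- c).
(* At [n = 0] the second condition would always hold, because the inverse of 0 is 0. *)
pose D n := (0 < n)%N && (n%:R^-1 <= phi n - phi (q + n)%N).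
have W0 x : 0 <= x -> 0 < W x by move=> /We; apply: lt_le_trans; exact: expR_gt0.
have lnW1 x : 0 <= x -> 1 <= ln (W x).
  by move=> x0; rewrite -[1](@expRK R) ler_ln ?We// posrE ?expR_gt0// W0.
have lnW0 x : 0 <= x -> 0 <= ln (W x) by move=> /lnW1; exact: le_trans.
have phi_drop n : 0 <= phi n - phi (q + n)%N.
  rewrite subr_ge0 /phi !powRN lef_pV2 ?posrE ?powR_gt0 ?(lt_le_trans ltr01) ?lnW1//.
  rewrite ge0_ler_powR ?nnegrE ?lnW0 ?(ltW c0)//.
  by rewrite ler_ln ?posrE ?W0// Wh// ler_nat leq_addl.
exists (\bigcup_(n in [set n | D n]) `[n%:R, n.+1%:R[%classic).
  apply: (finite_log_measure_bigcup D (\sum_(n < q) phi n)) => [n /andP[]//|N].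
  apply: le_trans (telescoping_drop phi q N (fun=> powR_ge0 _ _)).
  rewrite big_mkord big_mkcond/=; apply: ler_sum => n _.
  by case: ifPn => [/andP[]//|_]; exact: phi_drop.
move=> eps eps0.
pose K1 := 2 * K `^ (1 + c).
have K10 : 0 <= K1 by rewrite mulr_ge0// powR_ge0.
have t2 : 0 < tau / 2 by rewrite divr_gt0.
near=> r => nE.
have r1 : 1 <= r by near: r; exact: nbhs_pinfty_ge.
have r0 : 0 < r by exact: lt_le_trans r1.
have lnWr : ln (W r) <= K * r `^ rho by near: r.
pose n := Num.trunc r.
have /andP[nr rn] : n%:R <= r < n.+1%:R by apply: truncn_itv; exact: ltW.
have n0 : (0 < n)%N.
  have : 1%:R < n.+1%:R :> R by exact: le_lt_trans rn.
  by rewrite ltr_nat ltnS.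
have npos : 0 < n%:R :> R by rewrite ltr0n.
have n2r : n%:R^-1 <= 2 / r.
  (* Here [r < n + 1 <= 2 n]. *)
  rewrite ler_pdivlMr// mulrC ler_pdivrMr//.
  have : 1 <= n%:R :> R by rewrite ler1n.
  by move: rn; rewrite -(natr1 n); lra.
have drop : phi n - phi (q + n)%N < n%:R^-1.
  rewrite ltNge; apply/negP => h; apply: nE; exists n; first by rewrite /= /D n0.
  by rewrite /= in_itv/= nr.
set A := ln (W n%:R).
have A1 : 1 <= A by exact: lnW1.
have AK : A <= K * r `^ rho by apply: le_trans lnWr; rewrite ler_ln ?posrE ?W0// Wh// ltW.
have key : n%:R^-1 * A `^ (1 + c) <= K1 / (r `^ sigma * r `^ (tau / 2)).
  have : A `^ (1 + c) <= (K * r `^ rho) `^ (1 + c).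
    rewrite ge0_ler_powR ?nnegrE//; [lra|lra|].
    by rewrite mulr_ge0// powR_ge0.
  rewrite powRM ?powR_ge0// -powRrM => AcK.
  apply: (@le_trans _ _ (2 / r * (K `^ (1 + c) * r `^ (rho * (1 + c))))).
    by apply: ler_pM => //; exact: powR_ge0.
  have -> : rho * (1 + c) = 1 - (sigma + tau / 2).
    by rewrite /c /tau; field; rewrite gt_eqF.
  rewrite powRB ?(gt_eqF r0) ?implybT// powRr1 ?(ltW r0)// -powRD ?(gt_eqF r0) ?implybT//.
  rewrite /K1 le_eqVlt; apply/orP; left; apply/eqP; field.
  by rewrite !gt_eqF ?powR_gt0.
set B := K1 / _ in key.
have s1 : 1 <= r `^ sigma 
  by rewrite -[leLHS](powRr0 r); apply: ler_powR => //; exact: ltW.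
have s0 : 0 < r `^ sigma by exact: lt_le_trans s1.
have t0 : 0 < r `^ (tau / 2) by exact: powR_gt0.
have Bt : B <= K1 / r `^ (tau / 2).
  by rewrite ler_wpM2l// lef_pV2 ?posrE ?mulr_gt0// ler_peMl// ltW.
(* The first two bounds give the smallness hypotheses of [small_potential_drop], the third gives
   [eps]. *)
have [tK1 tK2 tK3] : [/\ 2 * K1 <= r `^ (tau / 2), 8 / c * K1 <= r `^ (tau / 2) &
    8 / (c * eps) * K1 <= r `^ (tau / 2)].
  by split; near: r; exact: powR_near_pinfty.
have B1 : B <= 2^-1 by apply: le_trans Bt _; rewrite ler_pdivrMr//; lra.
have B2 : B <= c / 8.
  apply: le_trans Bt _; rewrite ler_pdivrMr//.
  have : c / 8 * (8 / c * K1) <= c / 8 * r `^ (tau / 2) by rewrite ler_pM2l// divr_gt0.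
  by apply: le_trans; rewrite le_eqVlt; apply/orP; left; apply/eqP; field; rewrite gt_eqF.
have step := small_potential_drop c n%:R^-1 (W n%:R) (W (q + n)%:R) c0.
have Wnq : W (q + n)%:R - W n%:R <= 8 / c * (n%:R^-1 * A `^ (1 + c)) * W n%:R.
  apply: step; rewrite ?invr_gt0 ?We//; first by rewrite Wh// ler_nat leq_addl.
    exact: le_trans key B1.
  exact: le_trans key B2.
have Wnr : W n%:R <= W r by exact: Wh.
have Wpq : W (r + p%:R) <= W (q + n)%:R.
  apply: Wh; first by rewrite addr_ge0// ltW.
  by rewrite /q natrD -(natr1 p); move: rn; rewrite -(natr1 n); lra.
apply: (@le_trans _ _ (8 / c * B * W r)).
  apply: (@le_trans _ _ (8 / c * (n%:R^-1 * A `^ (1 + c)) * W n%:R)); first lra.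
  apply: ler_pM => //; last by rewrite ler_wpM2l// divr_ge0// ltW.
    by rewrite !mulr_ge0 ?invr_ge0 ?powR_ge0// ltW.
  exact/ltW/W0.
have Wr0 : 0 < W r by apply: W0; exact: ltW.
have -> : 8 / c * B * W r = 8 / (c * eps) * K1 * (eps * (W r / r `^ sigma)) / r `^ (tau / 2).
  by rewrite /B; field; rewrite !gt_eqF.
rewrite ler_pdivrMr// mulrC ler_wpM2l//.
by rewrite mulr_ge0 ?divr_ge0// ltW.
Unshelve. all: by end_near. Qed.

End Growth.

(** * Casoratian and characteristic *)

Section ShiftEstimate.
Context {R : realType}.

Lemma entire_or_constant_regular (g : R -> R) : tropical_entire g \/ constant_fun g ->
  [/\ locally_piecewise_linear g, forall x, 0 <= omega g x & chord_convex g].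
Proof.
case=> [[[_ gc gB] gN]|[k gk]]; last first.
  have -> : g = fun=> k by apply/funext.
  have lk := locally_piecewise_linear_cst k; have ck := chord_convex_cst k.
  by split=> // x; exact: chord_convex_omega_ge0.
have lg := piecewise_linear_locally g gc gB.
have og x : 0 <= omega g x by rewrite leNgt; apply/negP; exact: gN.
by split=> //; exact: omega_ge0_chord_convex.
Qed.

(** The outward increments of [g] at [r] and at [- r] add up to an increment of the second
    difference. Convexity bounds each below by its counterpart at 0, hence each above; the inward
    increment at [- r] is then enclosed by its neighbours. *)
Lemma shift_difference_bound (g : R -> R) (m k r : R) : chord_convex g ->
  0 <= r -> 0 <= k -> k <= m ->
  let D := second_difference g (r + m) - second_difference g r +
    (`|g k - g 0| + `|g (- k) - g 0|) in
  `|g (r + k) - g r| <= D /\ `|g (- r + k) - g (- r)| <= D.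
Proof.
move=> cg r0 k0 km /=.
have hmono : second_difference g (r + k) <= second_difference g (r + m).
  by apply: second_difference_homo => //; rewrite ?addr_ge0 ?lerD2l.
have hE : second_difference g (r + k) - second_difference g r =
    (g (r + k) - g r) + (g (- r - k) - g (- r)).
  by rewrite /second_difference opprD; lra.
have i1 := chord_convex_increment g 0 r k cg r0 k0.
have rN0 : - r <= 0 by lra.
have i2 := chord_convex_increment g (- r) 0 k cg rN0 k0.
have rkk : - r - k <= - k by lra.
have i3 := chord_convex_increment g (- r - k) (- k) k cg rkk k0.
have rkr : - r - k <= - r by lra.
have i4 := chord_convex_increment g (- r - k) (- r) k cg rkr k0.
rewrite add0r in i1 i2; rewrite subrK addNr in i3; rewrite subrK in i4.
have gk := ler_norm (g k - g 0); have gk' := ler_norm (g 0 - g k).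
have gN := ler_norm (g (- k) - g 0); have gN' := ler_norm (g 0 - g (- k)).
rewrite (distrC (g 0)) in gk'; rewrite (distrC (g 0)) in gN'.
have h0 : second_difference g r <= second_difference g (r + m).
  by apply: second_difference_homo => //; lra.
have n1 := normr_ge0 (g k - g 0); have n2 := normr_ge0 (g (- k) - g 0).
by rewrite !ler_norml; split; apply/andP; split; lra.
Qed.

Lemma nevanlinna_second_difference (m : nat) (F : 'I_m.+1 -> R -> R) (r : R) :
  nevanlinna_characteristic F r = 2^-1 * second_difference (max_fun F) r.
Proof. by rewrite /nevanlinna_characteristic /second_difference; lra. Qed.

Section Casoratian.
Variables (m : nat) (F : 'I_m.+1 -> R -> R).
Hypothesis cF : forall i, chord_convex (F i).

Lemma max_fun_chord_convex : chord_convex (max_fun F).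
Proof. by apply: big_max_closed => // u v; exact: chord_convex_max. Qed.

Lemma casoratian_chord_convex : chord_convex (casoratian F).
Proof.
have cs p : chord_convex (shift_sum F p).
  apply: big_sum_closed => [u v||i]; [exact: chord_convexD|exact: chord_convex_cst|].
  exact: chord_convex_shift.
by apply: big_max_closed => // u v; exact: chord_convex_max.
Qed.

Lemma casoratian_piecewise_linear :
  (forall i, locally_piecewise_linear (F i)) -> locally_piecewise_linear (casoratian F).
Proof.
move=> lF.
have ls p : locally_piecewise_linear (shift_sum F p).
  apply: big_sum_closed => [u v||i]; [exact: locally_piecewise_linearD| |].
    exact: locally_piecewise_linear_cst.
  exact: locally_piecewise_linear_shift.
by apply: big_max_closed => // u v; exact: locally_piecewise_linear_max.
Qed.

(** By the Jensen formula, twice the sum of the root counting functions when [0 < r]. *)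
Definition sum_second_difference (r : R) := \sum_(i < m.+1) second_difference (F i) r.

Local Notation S := sum_second_difference.

Lemma sum_second_difference_homo (x y : R) : 0 <= x -> x <= y -> S x <= S y.
Proof. by move=> x0 xy; apply: ler_sum => i _; exact: second_difference_homo. Qed.

Lemma sum_second_difference_ge0 (x : R) : 0 <= x -> 0 <= S x.
Proof. by move=> x0; apply: sumr_ge0 => i _; exact: second_difference_ge0. Qed.

Lemma casoratian_near_sum : exists c : R, forall r, 0 <= r ->
  let D := S (r + m%:R) - S r + c in
  `|casoratian F r - \sum_(i < m.+1) F i r| <= D /\
  `|casoratian F (- r) - \sum_(i < m.+1) F i (- r)| <= D.
Proof.
(* The bounded error of shifting [F i] by [k]; [c] sums it over all [k] so as not to depend on the
   permutation. *)
pose d i (k : 'I_m.+1) := `|F i k%:R - F i 0| + `|F i (- k%:R) - F i 0|.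
pose c := \sum_(i < m.+1) \sum_(k < m.+1) d i k.
exists c => r r0 D.
have DE : D = \sum_(i < m.+1) (second_difference (F i) (r + m%:R) -
    second_difference (F i) r + \sum_(k < m.+1) d i k).
  by rewrite big_split sumrB.
have key x : x = r \/ x = - r ->
    `|casoratian F x - \sum_(i < m.+1) F i x| <= D.
  move=> xr.
  have sp p : `|shift_sum F p x - \sum_(i < m.+1) F i x| <= D.
    rewrite DE -sumrB; apply: le_trans (ler_norm_sum _ _ _) _; apply: ler_sum => i _.
    have km : (p i)%:R <= m%:R :> R by rewrite ler_nat -ltnS.
    have [] := shift_difference_bound (F i) m%:R (p i)%:R r (cF i) r0 (ler0n _ _) km.
    have dk : d i (p i) <= \sum_(k < m.+1) d i k.
      rewrite (bigD1 (p i))//= lerDl sumr_ge0// => k _.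
      by rewrite addr_ge0.
    by rewrite -/(d i (p i)); case: xr => -> h1 h2; lra.
  (* The identity permutation alone gives the lower bound; the upper bound uses every
     permutation. *)
  rewrite ler_norml; apply/andP; split.
    have := sp 1%g; rewrite ler_norml => /andP[h _]; apply: le_trans h _.
    by rewrite lerD2r; exact: le_bigmax.
  rewrite lerBlDr; apply/bigmax_leP; split => [|p _].
    by have := sp 1%g; rewrite ler_norml => /andP[_]; rewrite lerBlDr.
  by have := sp p; rewrite ler_norml => /andP[_]; rewrite lerBlDr.
by split; apply: key; [left|right].
Qed.

Lemma casoratian_second_difference : exists c : R, forall r, 0 <= r ->
  `|2^-1 * S r - 2^-1 * second_difference (casoratian F) r| <= S (r + m%:R) - S r + c.
Proof.
have [c cP] := casoratian_near_sum.
exists (c + `|casoratian F 0 - \sum_(i < m.+1) F i 0|) => r /cP[].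
have -> : S r = \sum_(i < m.+1) F i r + \sum_(i < m.+1) F i (- r) -
    2 * \sum_(i < m.+1) F i 0.
  by rewrite mulr_sumr -big_split -sumrB.
rewrite /second_difference; set D := _ - _ + c.
set X := casoratian F r; set Y := casoratian F (- r); set Z := casoratian F 0.
set x := \sum_(i < _) F i r; set y := \sum_(i < _) F i (- r); set z := \sum_(i < _) F i 0.
rewrite !ler_norml addrA -/D => /andP[h1 h2] /andP[h3 h4].
have := ler_norm (Z - z); have := ler_norm (z - Z); rewrite distrC => h5 h6.
by apply/andP; split; lra.
Qed.

(** Each [F i] is at most [max_fun F] at [r] and [- r]; only the value at 0 enters with the opposite
    sign, and [c] pays for it. *)
Lemma sum_second_difference_nevanlinna : exists2 c : R, 0 <= c &
  forall r, S r <= 2 * m.+1%:R * nevanlinna_characteristic F r + c.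
Proof.
pose c := \sum_(i < m.+1) 2 * `|max_fun F 0 - F i 0|.
exists c; first by apply: sumr_ge0 => i _; rewrite mulr_ge0.
move=> r; rewrite nevanlinna_second_difference.
have Fle i x : F i x <= max_fun F x by exact: le_bigmax.
rewrite [X in _ <= X + _](_ : _ = \sum_(i < m.+1) second_difference (max_fun F) r).
  rewrite -big_split; apply: ler_sum => i _ /=; rewrite /second_difference.
  have := Fle i r; have := Fle i (- r); have := ler_norm (max_fun F 0 - F i 0); lra.
by rewrite sumr_const card_ord -mulr_natl; lra.
Qed.

End Casoratian.
End ShiftEstimate.

(** * Hyper-order and growth of the characteristic *)

Section HyperOrder.
Context {R : realType} {m : nat}.
Variable F : 'I_m.+1 -> R -> R.
Local Notation T := (nevanlinna_characteristic F).

(** Every neighbourhood of [+oo] contains a point where the quotient of logarithms is nonnegative.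
    This excludes the value [-oo], so that a hyper-order below 1 is a real number. *)
Lemma hyper_order_ge0 : (\forall r \near +oo%R, expR 1 <= T r) -> (0 <= hyper_order F)%E.
Proof.
move=> eT; apply: le_ereal_inf_tmp => _ [A Aoo <-].
have [r [Ar Tr r1]] : exists r, [/\ A r, expR 1 <= T r & 1 <= r].
  apply: (@filter_ex _ +oo%R); near=> r; split; near: r => //.
  exact: nbhs_pinfty_ge.
apply: le_trans (ereal_sup_ubound _); last by exists r.
rewrite lee_fin divr_ge0 ?ln_ge0//.
by rewrite -[leLHS](@expRK R) ler_ln// posrE ?expR_gt0// (lt_le_trans (expR_gt0 1)).
Unshelve. all: by end_near. Qed.

Lemma ln_le_powR_hyper_order (rho : R) : (\forall r \near +oo%R, expR 1 <= T r) ->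
  (hyper_order F < rho%:E)%E -> \forall r \near +oo%R, ln (T r) <= r `^ rho.
Proof.
move=> eT /ereal_inf_lt[_ [A Aoo <-] Arho]; near=> r.
have Ar : A r by near: r.
have r1 : 1 < r by near: r; exact: nbhs_pinfty_gt.
have Tr : expR 1 <= T r by near: r.
have : ((ln (ln (T r)) / ln r)%:E < rho%:E)%E.
  by apply: le_lt_trans Arho; apply: ereal_sup_ubound; exists r.
have lnr : 0 < ln r by exact: ln_gt0.
have T0 : 0 < T r by apply: lt_le_trans Tr; exact: expR_gt0.
have lnT : 0 < ln (T r).
  by apply: lt_le_trans ltr01 _; rewrite -[leLHS](@expRK R) ler_ln// posrE expR_gt0.
rewrite lte_fin ltr_pdivrMr// => h.
rewrite -[leLHS]lnK// /powR gt_eqF ?(lt_trans ltr01)// ler_expR.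
exact: ltW.
Unshelve. all: by end_near. Qed.

End HyperOrder.

Theorem corollary6p4 (R : realType) (m : nat) (m_ge1 : (1 <= m)%N)
    (f : R -> tropical_projective_space R m) (F : 'I_m.+1 -> R -> R)
    (f_curve : tropical_holomorphic_curve f)
    (F_reduced : reduced_representation f F)
    (rho2_lt1 : (hyper_order F < 1%:E)%E)
    (sigma : R) (sigma_gt0 : 0 < sigma)
    (sigma_lt : (sigma%:E < 1%:E - hyper_order F)%E) :
  exists2 E : set R, finite_log_measure E &
    (fun r : R =>
       \sum_(i < m.+1) counting_function r (tropical_inv (F i)) : R^o)
    = (fun r : R => counting_function r (tropical_inv (casoratian F)) : R^o)
      +o_ (pinfty_outside E)
      (fun r : R => nevanlinna_characteristic F r / r `^ sigma : R^o).
Proof.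
have [[Freg _ _] _] := F_reduced.
have lF i : locally_piecewise_linear (F i) by case: (entire_or_constant_regular _ (Freg i)).
have oF i x : 0 <= omega (F i) x by case: (entire_or_constant_regular _ (Freg i)).
have cF i : chord_convex (F i) by case: (entire_or_constant_regular _ (Freg i)).
have lC := casoratian_piecewise_linear m F lF.
have cC := casoratian_chord_convex m F cF.
have oC x : 0 <= omega (casoratian F) x by exact: chord_convex_omega_ge0.
have cM := max_fun_chord_convex m F cF.
pose T := nevanlinna_characteristic F.
have TE r : T r = 2^-1 * second_difference (max_fun F) r.
  exact: nevanlinna_second_difference.
pose S := sum_second_difference m F.
have NE r : 0 < r ->
    \sum_(i < m.+1) counting_function r (tropical_inv (F i)) = 2^-1 * S r.
  move=> r0; rewrite mulr_sumr; apply: eq_bigr => i _.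
  exact: counting_function_second_difference.
have NCE r : 0 < r -> counting_function r (tropical_inv (casoratian F)) =
    2^-1 * second_difference (casoratian F) r.
  by move=> r0; exact: counting_function_second_difference.
have [c0 SC] := casoratian_second_difference m F cF.
have [c1 c1_ge0 ST] := sum_second_difference_nevanlinna m F.
rewrite -/S -/T in SC ST.
(* Jensen's formula turns the little-o claim into an estimate on second differences; it applies
   because [r] is eventually positive. *)
have reduce (E : set R) : (forall eps, 0 < eps -> \forall r \near +oo%R, ~ E r ->
      `|2^-1 * S r - 2^-1 * second_difference (casoratian F) r| <=
      eps * `|T r / r `^ sigma|) ->
    (fun r : R => \sum_(i < m.+1) counting_function r (tropical_inv (F i)) : R^o)
    = (fun r : R => counting_function r (tropical_inv (casoratian F)) : R^o)
      +o_ (pinfty_outside E) (fun r : R => T r / r `^ sigma : R^o).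
  move=> h; apply/eqaddoP => eps eps0.
  suff : \forall r \near +oo%R, ~ E r ->
      `|\sum_(i < m.+1) counting_function r (tropical_inv (F i)) -
        counting_function r (tropical_inv (casoratian F))| <= eps * `|T r / r `^ sigma|.
    by [].
  have he := h eps eps0; near=> r; have r0 : 0 < r by near: r; exact: nbhs_pinfty_gt.
  by rewrite NE// NCE//; near: r.
(* If [T] is never positive on [[0, +oo[], then [S] is bounded by [c1], so it vanishes, and so does
   the second difference of the Casoratian: the empty exceptional set works. *)
have [[r0 r00 Tr0]|Tzero] := pselect (exists2 r, 0 <= r & 0 < T r); last first.
  have T0 r : 0 <= r -> T r <= 0.
    by move=> r0; rewrite leNgt; apply/negP => Tr; apply: Tzero; exists r.
  have S0 r : 0 <= r -> S r = 0.
    move=> r0; apply: big1 => i _.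
    apply: (bounded_second_difference _ (cF i) c1) r0 => x x0.
    apply: (@le_trans _ _ (S x)).
      rewrite /S /sum_second_difference (bigD1 i)//= lerDl sumr_ge0// => j _.
      exact: second_difference_ge0.
    apply: le_trans (ST x) _; rewrite gerDr pmulr_rle0 ?T0// mulr_gt0// ltr0n.
  have C0 r : 0 <= r -> second_difference (casoratian F) r = 0.
    apply: (bounded_second_difference _ cC (2 * c0)) => x x0.
    have xm : 0 <= x + m%:R by rewrite addr_ge0.
    by have := SC x x0; rewrite !S0// ler_norml => /andP[]; lra.
  exists set0; first by split => //; rewrite set0I integral_set0.
  apply: reduce => eps eps0; near=> r => _.
  have r0 : 0 <= r by near: r; exact: nbhs_pinfty_ge.
  by rewrite S0// C0// mulr0 subrr normr0 mulr_ge0// ltW.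
have r0_gt0 : 0 < r0.
  rewrite lt_neqAle r00 andbT; apply/eqP => r0E; move: Tr0.
  by rewrite -r0E TE /second_difference oppr0; lra.
(* Slope of the chord of [T] from the origin, which bounds [T] from below by a linear function
   beyond [r0]. *)
pose kappa := T r0 / r0; have kappa0 : 0 < kappa by exact: divr_gt0.
have Tlin r : r0 <= r -> kappa * r <= T r.
  move=> rr; rewrite /kappa mulrAC ler_pdivrMr// !TE.
  have := second_difference_chord _ cM r0 r r00 rr; lra.
have T_homo x y : 0 <= x -> x <= y -> T x <= T y.
  by move=> x0 xy; rewrite !TE ler_pM2l ?invr_gt0// second_difference_homo.
have T_ge0 x : 0 <= x -> 0 <= T x.
  by move=> x0; rewrite TE mulr_ge0 ?invr_ge0// second_difference_ge0.
have Te : \forall r \near +oo%R, expR 1 <= T r.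
  near=> r; apply: (@le_trans _ _ (kappa * r)); last first.
    by apply: Tlin; near: r; exact/nbhs_pinfty_ge/num_real.
  by rewrite -ler_pdivrMl//; near: r; exact/nbhs_pinfty_ge/num_real.
have ho0 := hyper_order_ge0 F Te.
have hofin : hyper_order F \is a fin_num.
  by rewrite ge0_fin_numE// (lt_trans rho2_lt1)// ltry.
pose h := fine (hyper_order F).
have h0 : 0 <= h by exact: fine_ge0.
have hs : sigma < 1 - h by move: sigma_lt; rewrite -(fineK hofin) -EFinB lte_fin.
(* The midpoint of [h] and [1 - sigma]: above the hyper-order, yet with [rho + sigma < 1]. *)
pose rho := (h + (1 - sigma)) / 2.
have lnT : \forall r \near +oo%R, ln (T r) <= r `^ rho.
  apply: ln_le_powR_hyper_order Te _.
  by rewrite -(fineK hofin) lte_fin -/h /rho; lra.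
(* As [T] is nondecreasing, increments of [W] dominate those of [S]; the summand [expR 1] gives the
   lower bound that the growth lemma requires from 0 on. *)
pose W r := S r + T r + expR 1.
pose C0 := 2 * m.+1%:R + c1 + 1 + expR 1.
have e0 := expR_gt0 (1 : R).
have m0 : 0 <= m.+1%:R :> R by [].
have C01 : 1 <= C0 by rewrite /C0; lra.
have e1 : 1 <= expR 1 :> R by have := expR_ge1Dx (1 : R); lra.
have WT : \forall r \near +oo%R, W r <= C0 * T r.
  near=> r; have : expR 1 <= T r by near: r.
  move=> eT; have T1 : 1 <= T r by exact: le_trans eT.
  have := ST r; rewrite /W /C0 -/S -/(T r) => ?.
  have : c1 * 1 <= c1 * T r by exact: ler_wpM2l.
  have : expR 1 * 1 <= expR 1 * T r by rewrite ler_wpM2l// ltW.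
  lra.
have [|||||||E Efin EW] := increment_small_outside W m rho sigma (ln C0 + 1).
- by move=> x y x0 xy; rewrite /W lerD2r lerD ?T_homo//; exact: sum_second_difference_homo.
- move=> x x0; rewrite /W lerDr addr_ge0 ?T_ge0//; exact: sum_second_difference_ge0.
- by rewrite /rho; lra.
- by [].
- by rewrite /rho; lra.
- by rewrite addr_ge0// ln_ge0.
- near=> r.
  have eT : expR 1 <= T r by near: r.
  have T0 : 0 < T r by exact: lt_le_trans eT.
  have W0 : 0 < W r.
    have r_ge0 : 0 <= r by near: r; exact: nbhs_pinfty_ge.
    have S_ge0 : 0 <= S r by exact: sum_second_difference_ge0.
    by rewrite /W; lra.
  have C00 : 0 < C0 by exact: lt_le_trans C01.
  have WTr : W r <= C0 * T r by near: r.
  have lnTr : ln (T r) <= r `^ rho by near: r.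
  apply: (@le_trans _ _ (ln C0 + ln (T r))).
    by rewrite -lnM ?posrE// ler_ln ?posrE// mulr_gt0.
  (* The constant [ln C0] is absorbed because [r ^ rho >= 1]. *)
  rewrite mulrDl mul1r lerD// ler_peMr ?ln_ge0//.
  have r1 : 1 <= r by near: r; exact: nbhs_pinfty_ge.
  by rewrite -[leLHS](powRr0 r); apply: ler_powR => //; rewrite /rho; lra.
exists E => //; apply: reduce => eps eps0.
have C00 : 0 < C0 by exact: lt_le_trans C01.
(* Half of [eps] goes to the increment of [S], after [W <= C0 * T], and the other half to the
   constant [c0]. *)
have eC0 : 0 < eps / (2 * C0) by rewrite divr_gt0// mulr_gt0.
have EWe := EW _ eC0.
near=> r => nE.
have r_gt0 : 0 < r by near: r; exact: nbhs_pinfty_gt.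
have Winc : W (r + m%:R) - W r <= eps / (2 * C0) * (W r / r `^ sigma).
  by move: nE; near: r.
have WTr : W r <= C0 * T r by near: r.
have p0 : 0 < r `^ sigma by exact: powR_gt0.
have Tinc : T r <= T (r + m%:R) by apply: T_homo; [exact: ltW|rewrite lerDl].
have Sinc : S (r + m%:R) - S r <= eps / 2 * (T r / r `^ sigma).
  apply: (@le_trans _ _ (W (r + m%:R) - W r)); first by rewrite /W; lra.
  apply: le_trans Winc _.
  have -> : eps / 2 * (T r / r `^ sigma) = eps / (2 * C0) * (C0 * T r / r `^ sigma).
    by field; rewrite !gt_eqF.
  by rewrite ler_pM2l// ler_pM2r// invr_gt0.
(* The quotient [T r / r ^ sigma] is at least [kappa * r ^ (1 - sigma)], which tends to infinity. *)
have c0T : c0 <= eps / 2 * (T r / r `^ sigma).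
  have rT : kappa * r <= T r by apply: Tlin; near: r; exact/nbhs_pinfty_ge/num_real.
  have : c0 * 2 / (eps * kappa) <= r `^ (1 - sigma).
    by near: r; apply: powR_near_pinfty; lra.
  have ek0 : 0 < eps * kappa by exact: mulr_gt0.
  rewrite ler_pdivrMr// powRB ?(gt_eqF r_gt0) ?implybT// powRr1 ?(ltW r_gt0)// => hc.
  have : kappa * r / r `^ sigma <= T r / r `^ sigma by rewrite ler_pM2r ?invr_gt0.
  rewrite -(ler_pM2l eps0) => hk.
  have : c0 * 2 <= eps * (T r / r `^ sigma).
    by apply: le_trans hc _; apply: le_trans hk; rewrite le_eqVlt; apply/orP; left;
       apply/eqP; ring.
  lra.
have Tp : 0 <= T r / r `^ sigma by rewrite divr_ge0 ?T_ge0// ltW.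
rewrite (ger0_norm Tp); apply: le_trans (SC r (ltW r_gt0)) _.
by rewrite -/S; lra.
Unshelve. all: by end_near. Qed.
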